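(* For every graph $H$ and every integer $d\geq 2$, if the $d$-Cut problem is polynomial-time solvable for $H$-free graphs, then the $d$-Cut problem is polynomial-time solvable for $(H+P_1)$-free graphs.
   Context: All graphs are finite and undirected, without multiple edges or self-loops. For an integer $d\geq 1$ and a connected graph $G=(V,E)$, a set $M\subseteq E$ is a $d$-cut of $G$ if $V$ can be partitioned into two non-empty sets $B$ and $R$ such that (i) $M$ is the set of all edges with one end-vertex in $B$ and the other in $R$; and (ii) every vertex in $B$ has at most $d$ neighbours in $R$, and every vertex in $R$ has at most $d$ neighbours in $B$. For a fixed integer $d\geq 1$ (not part of the input), the $d$-Cut problem takes as input a connected graph $G$ and asks whether $G$ has a $d$-cut. A graph $G$ is $H$-free, for a fixed graph $H$, if $G$ does not contain $H$ as an induced subgraph. $P_1$ is the one-vertex graph, and $H+P_1$ is the disjoint union of $H$ and $P_1$. *)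

(* Defs.v *)
From HB Require Import structures.
From mathcomp Require Import all_boot all_order all_algebra.

Set Implicit Arguments.
Unset Strict Implicit.
Unset Printing Implicit Defensive.

Record sgraph := SGraph {
  vertex :> finType;
  adj : rel vertex;
  adj_sym : symmetric adj;
  adj_irrefl : irreflexive adj }.

Definition connected (G : sgraph) : Prop :=
  0 < #|G| /\ forall x y : G, connect (@adj G) x y.

Section Induced.
Variables (G : sgraph) (S : {set G}).

Definition induced_adj : rel {x : G | x \in S} := fun x y => adj (val x) (val y).

Fact induced_sym : symmetric induced_adj.
Proof. by move=> x y; apply: adj_sym. Qed.

Fact induced_irrefl : irreflexive induced_adj.
Proof. by move=> x; apply: adj_irrefl. Qed.

Definition induced : sgraph := SGraph induced_sym induced_irrefl.
End Induced.

Definition isomorphic (G1 G2 : sgraph) : Prop :=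
  exists2 f : G1 -> G2, bijective f & forall x y, adj (f x) (f y) = adj x y.

Definition free (H G : sgraph) : Prop :=
  ~ exists S : {set G}, isomorphic (induced S) H.

Section DisjointUnion.
Variables G1 G2 : sgraph.

Definition dunion_adj : rel (G1 + G2)%type := fun x y =>
  match x, y with
  | inl x1, inl y1 => adj x1 y1
  | inr x2, inr y2 => adj x2 y2
  | _, _ => false
  end.

Fact dunion_sym : symmetric dunion_adj.
Proof. by move=> [x|x] [y|y] //=; apply: adj_sym. Qed.

Fact dunion_irrefl : irreflexive dunion_adj.
Proof. by move=> [x|x] /=; apply: adj_irrefl. Qed.

Definition dunion : sgraph := SGraph dunion_sym dunion_irrefl.
End DisjointUnion.

Definition P1 : sgraph :=
  @SGraph unit (fun _ _ => false) (fun _ _ => erefl) (fun _ => erefl).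

Definition edges (G : sgraph) : {set {set G}} :=
  [set e | [exists x, exists y, adj x y && (e == [set x; y])]].

Definition edges_between (G : sgraph) (B R : {set G}) : {set {set G}} :=
  [set e in edges G | [exists x in B, exists y in R, e == [set x; y]]].

Definition is_dcut (d : nat) (G : sgraph) (M : {set {set G}}) : Prop :=
  exists B R : {set G},
    [/\ B != set0, R != set0, [disjoint B & R] & B :|: R = [set: G]] /\
    [/\ M = edges_between B R,
        forall x, x \in B -> #|[set y in R | adj x y]| <= d
      & forall x, x \in R -> #|[set y in B | adj x y]| <= d].

Definition has_dcut (d : nat) (G : sgraph) : Prop :=
  exists2 M : {set {set G}}, M \subset edges G & is_dcut d M.

(* Deterministic multi-tape Turing machines. There are [tm_tapes.+1] two-way
   infinite tapes, indexed by [int]. A cell holds [None] (blank), [Some (inl b)]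
   (an input bit) or [Some (inr s)] (a work symbol). The machine halts in a state
   whose verdict is [Some true] (accept) or [Some false] (reject). *)

Inductive move := MoveLeft | Stay | MoveRight.

Definition shift (m : move) : int :=
  match m with MoveLeft => (-1)%R | Stay => 0%R | MoveRight => 1%R end.

Record tm := TM {
  tm_state : finType;
  tm_work : finType;
  tm_tapes : nat;
  tm_start : tm_state;
  tm_verdict : tm_state -> option bool;
  tm_delta : tm_state -> {ffun 'I_tm_tapes.+1 -> option (bool + tm_work)} ->
             tm_state * {ffun 'I_tm_tapes.+1 -> option (bool + tm_work) * move} }.

Definition cell (M : tm) : Type := option (bool + tm_work M).

Record config (M : tm) := Config {
  cstate : tm_state M;
  ctape : 'I_(tm_tapes M).+1 -> int -> cell M;
  chead : 'I_(tm_tapes M).+1 -> int }.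

Definition step (M : tm) (c : config M) : config M :=
  if tm_verdict (cstate c) is Some _ then c else
  let a := tm_delta (cstate c) [ffun i => ctape c i (chead c i)] in
  Config a.1
    (fun i z => if z == chead c i then (a.2 i).1 else ctape c i z)
    (fun i => (chead c i + shift (a.2 i).2)%R).

Definition init (M : tm) (w : seq bool) : config M :=
  Config (tm_start M)
    (fun i z => match z with
                | Posz n => if i == ord0 then nth None [seq Some (inl b) | b <- w] n
                            else None
                | Negz _ => None
                end)
    (fun _ => 0%R).

Definition answers_within (M : tm) (w : seq bool) (t : nat) (b : bool) : Prop :=
  exists2 s, s <= t & tm_verdict (cstate (iter s (@step M) (init M w))) = Some b.

(* The number of vertices in unary, a separator, then the adjacency matrix row
   by row. *)
Definition encode (G : sgraph) : seq bool :=
  nseq #|G| true ++ false :: [seq adj x y | x <- enum G, y <- enum G].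

(* The problem [P] restricted to inputs in the class [C]; nothing is required of
   the machine on words that do not encode a graph of [C]. *)
Definition poly_time_solvable (C P : sgraph -> Prop) : Prop :=
  exists (M : tm) (p : {poly nat}), forall G : sgraph, C G ->
    exists2 b : bool, b <-> P G &
      answers_within M (encode G) p.[size (encode G)]%R b.

Definition dcut_poly_time (d : nat) (H : sgraph) : Prop :=
  poly_time_solvable (fun G => connected G /\ free H G) (has_dcut d).

(* Main.v *)
(* If a connected [(H + P1)]-free graph [G] contains an induced copy of [H], then
   every vertex outside this copy has a neighbour in it, so [k = #|H|] vertices
   dominate [G]. Given a [d]-cut, let [S1] be the set of dominating vertices on
   one side: painting the neighbourhood of [S1] in one colour and the rest of [G]
   in the other is wrong for at most [(d + 1) k] vertices. Trying all choices of
   at most [k] vertices and of at most [(d + 1) k] corrections therefore decides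
   the problem in polynomial time, and if no [k] vertices almost dominate [G], then
   [G] is [H]-free and the given machine for [H]-free graphs takes over.

   On the machine, a choice is stored as marks on a tape whose cells correspond to
   the vertices, one track per chosen vertex; nested loops move the marks, and
   everything else is a row by row scan of the adjacency matrix. *)

Require Import Defs.
From mathcomp Require Import all_boot all_order all_algebra.
From mathcomp Require Import zify.
From Stdlib Require Import FunctionalExtensionality.

Set Implicit Arguments.
Unset Strict Implicit.
Unset Printing Implicit Defensive.

(** Cell [-1] and the cell behind the word are both blank, so a moving head detects either end
    without end markers. *)
Definition tape_of (A : Type) (s : seq A) (z : int) : option A :=
  match z with Posz n => nth None (map Some s) n | Negz _ => None end.

Definition write (A : Type) (t : int -> option A) (h : int) (a : option A) :=
  fun z => if z == h then a else t z.

(** * Program fragments on one input tape and two work tapes *)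

Section Tapes.
Variable A : Type.
Implicit Types (l r s : seq A) (a b : A).

Lemma tape_of_mid l a r : tape_of (l ++ a :: r) (size l) = Some a.
Proof. by rewrite /= map_cat nth_cat size_map ltnn subnn. Qed.

Lemma tape_of_end s : tape_of s (size s) = None.
Proof. by rewrite /= nth_default // size_map. Qed.

Lemma tape_of_some s i : i < size s -> tape_of s i <> None.
Proof.
elim: s i => // a s IHs [|i] //= lti; exact: (IHs i).
Qed.

Lemma write_same (t : int -> option A) h : write t h (t h) = t.
Proof. by apply: functional_extensionality => z; rewrite /write; case: eqP => [->|]. Qed.

Lemma write_mid l a b r :
  write (tape_of (l ++ a :: r)) (size l) (Some b) = tape_of (l ++ b :: r).
Proof.
apply: functional_extensionality => -[i|i] //; rewrite /write eqz_nat.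
have [->|] := eqVneq i (size l); first by rewrite tape_of_mid.
by rewrite /= !map_cat !nth_cat !size_map /=; case: ltngtP => // /subnSK <-.
Qed.

Lemma write_blank s : write (tape_of s) (size s) None = tape_of s.
Proof. by rewrite -[X in write _ _ X](tape_of_end s) write_same. Qed.

Lemma write_end s b : write (tape_of s) (size s) (Some b) = tape_of (rcons s b).
Proof.
apply: functional_extensionality => -[i|i] //; rewrite /write eqz_nat -cats1.
have [->|neq] := eqVneq i (size s); first by rewrite tape_of_mid.
rewrite /= !map_cat !nth_cat !size_map /=; case: ltngtP neq => //= lti _.
have -> : i - size s = (i - size s).-1.+1 by lia.
by rewrite !nth_default // size_map; lia.
Qed.

End Tapes.

Arguments tape_of : simpl never.

Record action (T : Type) := Action {
  imove : move;
  cwrite : option T; cmove : move;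
  rwrite : option T; rmove : move }.

(* A program fragment is entered with a value of [X] and left with a value of [Y];
   the finite control of the machine is carried by these values. The input tape is
   read-only; the two work tapes, "column" and "row", have alphabet [T]. *)
Record flow (T : Type) (X Y : Type) := Flow {
  fstate : finType;
  fstart : X -> fstate;
  fdelta : fstate -> option bool -> option T -> option T ->
           (fstate + Y) * action T }.

Record conf (T : Type) := Conf {
  ihead : int;
  ctp : int -> option T; chd : int;
  rtp : int -> option T; rhd : int }.

(** * Composition of program fragments, with time bounds *)

Section Flow.
Variables (T : Type) (w : seq bool).
Implicit Types (c : conf T) (X Y Z : Type).

Definition perform (a : action T) c : conf T :=
  Conf (ihead c + shift (imove a))%R
       (write (ctp c) (chd c) (cwrite a)) (chd c + shift (cmove a))%R
       (write (rtp c) (rhd c) (rwrite a)) (rhd c + shift (rmove a))%R.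

Definition fstep X Y (m : flow T X Y) (p : (fstate m + Y) * conf T) :=
  match p.1 with
  | inl s =>
      let: (o, a) := fdelta s (tape_of w (ihead p.2))
                        (ctp p.2 (chd p.2)) (rtp p.2 (rhd p.2)) in
      (o, perform a p.2)
  | inr _ => p
  end.

(* Exits are absorbing, so this says "within [t] steps". *)
Definition run X Y (m : flow T X Y) x c y c' t :=
  iter t (@fstep X Y m) (inl (fstart m x), c) = (inr y, c').

Lemma iter_exit X Y (m : flow T X Y) t y c :
  iter t (@fstep X Y m) (inr y, c) = (inr y, c).
Proof. by elim: t => //= t ->. Qed.

Lemma iter_weaken X Y (m : flow T X Y) p y c t t' : t <= t' ->
  iter t (@fstep X Y m) p = (inr y, c) -> iter t' (@fstep X Y m) p = (inr y, c).
Proof. by move=> /subnK <- e; rewrite iterD e iter_exit. Qed.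

Lemma run_weaken X Y (m : flow T X Y) x c y c' t t' : t <= t' ->
  run m x c y c' t -> run m x c y c' t'.
Proof. exact: iter_weaken. Qed.

(** The common argument behind all combinators: each one copies its component up to renaming of
    states by [phi] and redirects the exits by [psi]. After the exit [m1] idles whereas [m2] may
    continue, so the exact exit time [t'] has to be recovered from the bound [t]. *)
Lemma simulation X1 Y1 X2 Y2 (m1 : flow T X1 Y1) (m2 : flow T X2 Y2)
    (phi : fstate m1 -> fstate m2) (psi : Y1 -> fstate m2 + Y2) :
    (forall s a b r, fdelta (phi s) a b r =
       (match (fdelta s a b r).1 with inl s' => inl (phi s') | inr y => psi y end,
        (fdelta s a b r).2)) ->
  forall t s c y c', iter t (@fstep X1 Y1 m1) (inl s, c) = (inr y, c') ->
  exists2 t', t' <= t & iter t' (@fstep X2 Y2 m2) (inl (phi s), c) = (psi y, c').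
Proof.
move=> simE; elim=> // t IHt s c y c'.
rewrite iterSr {2}/fstep /=; case E: (fdelta s _ _ _) => [[s1|y1] a] H.
  have [t' le_t' H'] := IHt _ _ _ _ H; exists t'.+1 => //.
  by rewrite iterSr {2}/fstep /= simE E.
move: H; rewrite iter_exit => -[<- <-]; exists 1 => //.
by rewrite /= {1}/fstep /= simE E.
Qed.

Definition act (X : finType) Y
    (f : X -> option bool -> option T -> option T -> Y * action T) : flow T X Y :=
  Flow id (fun x a b r => (inr (f x a b r).1, (f x a b r).2)).

Definition dimap X X' Y Y' (f : X' -> X) (g : Y -> Y') (m : flow T X Y) : flow T X' Y' :=
  Flow (fstart m \o f) (fun s a b r =>
    (match (fdelta s a b r).1 with inl s' => inl s' | inr y => inr (g y) end,
     (fdelta s a b r).2)).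

(* Exits on the left continue in [m2], exits on the right leave the fragment. *)
Definition bindl X Y Z (m1 : flow T X (Y + Z)) (m2 : flow T Y Z) : flow T X Z :=
  @Flow T X Z (fstate m1 + fstate m2)%type (fun x => inl (fstart m1 x))
    (fun s a b r => match s with
     | inl s1 => (match (fdelta s1 a b r).1 with
                  | inl s' => inl (inl s')
                  | inr (inl y) => inl (inr (fstart m2 y))
                  | inr (inr z) => inr z
                  end, (fdelta s1 a b r).2)
     | inr s2 => (match (fdelta s2 a b r).1 with
                  | inl s' => inl (inr s')
                  | inr z => inr z
                  end, (fdelta s2 a b r).2)
     end).

Definition seqf X Y Z (m1 : flow T X Y) (m2 : flow T Y Z) : flow T X Z :=
  bindl (dimap id inl m1) m2.

(** A left exit plays the role of [continue], a right exit that of [break]. *)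
Definition loop X Y (m : flow T X (X + Y)) : flow T X Y :=
  Flow (fstart m) (fun s a b r =>
    (match (fdelta s a b r).1 with
     | inl s' => inl s'
     | inr (inl x) => inl (fstart m x)
     | inr (inr y) => inr y
     end, (fdelta s a b r).2)).

Lemma run_act (X : finType) Y
    (f : X -> option bool -> option T -> option T -> Y * action T) x c y a c' :
  f x (tape_of w (ihead c)) (ctp c (chd c)) (rtp c (rhd c)) = (y, a) ->
  perform a c = c' -> run (act f) x c y c' 1.
Proof. by rewrite /run /= /fstep /= => -> /= ->. Qed.

Lemma run_dimap X X' Y Y' (f : X' -> X) (g : Y -> Y') (m : flow T X Y) x c y c' t :
  run m (f x) c y c' t -> run (dimap f g m) x c (g y) c' t.
Proof.
move=> /(@simulation _ _ _ _ m (dimap f g m) id (inr \o g)) [//|t' le_t'].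
exact: iter_weaken.
Qed.

Lemma run_bindl_exit X Y Z (m1 : flow T X (Y + Z)) (m2 : flow T Y Z) x c z c' t :
  run m1 x c (inr z) c' t -> run (bindl m1 m2) x c z c' t.
Proof.
move=> /(@simulation _ _ _ _ m1 (bindl m1 m2) inl
  (fun o => match o with inl y => inl (inr (fstart m2 y)) | inr z => inr z end)).
case=> [s a b r /=|t' le_t']; last exact: iter_weaken.
by case: (fdelta s a b r) => [[]].
Qed.

Lemma run_bindl X Y Z (m1 : flow T X (Y + Z)) (m2 : flow T Y Z) x c y c1 z c2 t1 t2 :
  run m1 x c (inl y) c1 t1 -> run m2 y c1 z c2 t2 ->
  run (bindl m1 m2) x c z c2 (t1 + t2).
Proof.
move=> /(@simulation _ _ _ _ m1 (bindl m1 m2) inl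
  (fun o => match o with inl y => inl (inr (fstart m2 y)) | inr z => inr z end)).
case=> [s a b r /=|t1' le_t1 e1]; first by case: (fdelta s a b r) => [[]].
move=> /(@simulation _ _ _ _ m2 (bindl m1 m2) inr inr) [s a b r //|t2' le_t2 e2].
apply: (@iter_weaken _ _ _ _ _ _ (t2' + t1')); first by rewrite addnC leq_add.
by rewrite iterD e1 e2.
Qed.

Lemma run_seqf X Y Z (m1 : flow T X Y) (m2 : flow T Y Z) x c y c1 z c2 t1 t2 :
  run m1 x c y c1 t1 -> run m2 y c1 z c2 t2 ->
  run (seqf m1 m2) x c z c2 (t1 + t2).
Proof. by move=> r1; apply: run_bindl; apply: run_dimap. Qed.

Lemma run_loop_exit X Y (m : flow T X (X + Y)) x c y c' t :
  run m x c (inr y) c' t -> run (loop m) x c y c' t.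
Proof.
move=> /(@simulation _ _ _ _ m (loop m) id
  (fun o => match o with inl x => inl (fstart m x) | inr y => inr y end)).
case=> [s a b r //|t' le_t']; exact: iter_weaken.
Qed.

Lemma run_loop X Y (m : flow T X (X + Y)) x c x1 c1 y c2 t1 t2 :
  run m x c (inl x1) c1 t1 -> run (loop m) x1 c1 y c2 t2 ->
  run (loop m) x c y c2 (t1 + t2).
Proof.
move=> /(@simulation _ _ _ _ m (loop m) id
  (fun o => match o with inl x => inl (fstart m x) | inr y => inr y end)).
case=> [s a b r //|t1' le_t1 e1 e2].
apply: (@iter_weaken _ _ _ _ _ _ (t2 + t1')); first by rewrite addnC leq_add2r.
by rewrite iterD e1 e2.
Qed.

End Flow.
Inductive head := HInput | HCol | HRow.

Lemma addz1 (n : nat) : (n%:Z + 1)%R = n.+1.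
Proof. by rewrite -addn1. Qed.

(** * Scans of the work tapes and of the adjacency matrix *)

Section Primitives.
Variables (T : finType) (w : seq bool).
Implicit Types (c : conf T) (X Y Z : finType) (s l : seq T).

Definition set_head h z c : conf T :=
  match h with
  | HInput => Conf z (ctp c) (chd c) (rtp c) (rhd c)
  | HCol => Conf (ihead c) (ctp c) z (rtp c) (rhd c)
  | HRow => Conf (ihead c) (ctp c) (chd c) (rtp c) z
  end.

Definition on_head A (h : head) (a b r : A) : A :=
  match h with HInput => a | HCol => b | HRow => r end.

Definition blank_at h c z : bool :=
  on_head h (tape_of w z == None) (ctp c z == None) (rtp c z == None).

(** Every action writes on both work tapes; a pure head move therefore writes back the symbols [b]
    and [r] just read. *)
Definition shift_head h d (b r : option T) : action T :=
  Action (on_head h d Stay Stay) b (on_head h Stay d Stay)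
         r (on_head h Stay Stay d).

Lemma perform_shift_head h d c z :
  let c' := set_head h z c in
  perform (shift_head h d (ctp c' (chd c')) (rtp c' (rhd c'))) c'
  = set_head h (z + shift d)%R c.
Proof. by case: h; rewrite /perform /= !write_same !GRing.addr0. Qed.

Lemma blank_at_head h c z : let c' := set_head h z c in
  on_head h (tape_of w (ihead c') == None) (ctp c' (chd c') == None)
    (rtp c' (rhd c') == None) = blank_at h c z.
Proof. by case: h. Qed.

Definition rewind_loop X h : flow T X X :=
  loop (act (fun x a b r =>
    if on_head h (a == None) (b == None) (r == None)
    then (inr x, shift_head h MoveRight b r)
    else (inl x, shift_head h MoveLeft b r))).

(** Scans end on the blank behind the word, where the loop would stop at once; hence the
    unconditional first step to the left. *)
Definition rewind X h : flow T X X :=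
  seqf (act (fun x a b r => (x, shift_head h MoveLeft b r))) (rewind_loop X h).

Lemma run_rewind_loop X h (x : X) c n :
  blank_at h c (-1)%R -> (forall i : nat, i < n -> ~~ blank_at h c i) ->
  run w (rewind_loop X h) x (set_head h (n%:Z - 1)%R c) x (set_head h 0%R c) n.+1.
Proof.
move=> blankN1; elim: n => [|n IHn] nonblank.
  apply: run_loop_exit; apply: run_act; first by rewrite blank_at_head blankN1.
  by rewrite perform_shift_head.
rewrite -[X in run _ _ _ _ _ _ X]add1n; apply: run_loop; last first.
  by apply: IHn => i lt_in; apply: nonblank; apply: ltnW.
have /negbTE nbn := nonblank n (leqnn _).
have -> : (n.+1%:Z - 1 = n)%R by lia.
apply: run_act; first by rewrite blank_at_head nbn.
by rewrite perform_shift_head.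
Qed.

Lemma run_rewind X h (x : X) c n :
  blank_at h c (-1)%R -> (forall i : nat, i < n -> ~~ blank_at h c i) ->
  run w (rewind X h) x (set_head h n c) x (set_head h 0%R c) n.+2.
Proof.
move=> blankN1 nonblank; rewrite -[X in run _ _ _ _ _ _ X]add1n.
apply: run_seqf (run_rewind_loop x blankN1 nonblank).
by apply: run_act => //; rewrite perform_shift_head.
Qed.

Lemma tape_of_nonblank (A : eqType) (u : seq A) i : i < size u -> tape_of u i != None.
Proof. by move=> lti; apply/eqP/tape_of_some. Qed.

Lemma run_rewind_col X (x : X) z s n rt rh : n <= size s ->
  run w (rewind X HCol) x (Conf z (tape_of s) n rt rh)
    x (Conf z (tape_of s) 0%R rt rh) n.+2.
Proof.
move=> le_n; apply: (@run_rewind X HCol x (Conf z (tape_of s) 0%R rt rh)) => //.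
by move=> i lt_in; apply: tape_of_nonblank; apply: leq_trans le_n.
Qed.

Lemma run_rewind_row X (x : X) z ct ch r n : n <= size r ->
  run w (rewind X HRow) x (Conf z ct ch (tape_of r) n)
    x (Conf z ct ch (tape_of r) 0%R) n.+2.
Proof.
move=> le_n; apply: (@run_rewind X HRow x (Conf z ct ch (tape_of r) 0%R)) => //.
by move=> i lt_in; apply: tape_of_nonblank; apply: leq_trans le_n.
Qed.

Lemma run_rewind_input X (x : X) ct ch rt rh n : n <= size w ->
  run w (rewind X HInput) x (Conf n ct ch rt rh)
    x (Conf 0%R ct ch rt rh) n.+2.
Proof.
move=> le_n; apply: (@run_rewind X HInput x (Conf 0%R ct ch rt rh)) => //.
by move=> i lt_in; apply: tape_of_nonblank; apply: leq_trans le_n.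
Qed.

(** A Mealy machine with state set [Z], run over the column tape and rewriting it in place. *)
Fixpoint sweepf Z (g : Z -> T -> Z * T) z s : Z * seq T :=
  if s is a :: s' then
    let: (z1, a') := g z a in let: (z2, s'') := sweepf g z1 s' in (z2, a' :: s'')
  else (z, [::]).

Lemma size_sweepf Z (g : Z -> T -> Z * T) z s : size (sweepf g z s).2 = size s.
Proof.
elim: s z => //= a s IHs z; case: (g z a) => z1 a'.
by case: sweepf (IHs z1) => z2 s'' /= ->.
Qed.

Definition sweep_loop Z (g : Z -> T -> Z * T) : flow T Z Z :=
  loop (act (fun z _ b r =>
    if b is Some a
    then (inl (g z a).1, Action Stay (Some (g z a).2) MoveRight r Stay)
    else (inr z, Action Stay b Stay r Stay))).

Definition sweep Z (g : Z -> T -> Z * T) : flow T Z Z :=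
  seqf (sweep_loop g) (rewind Z HCol).

Lemma run_sweep_loop Z (g : Z -> T -> Z * T) z i l s rt rh :
  run w (sweep_loop g) z (Conf i (tape_of (l ++ s)) (size l) rt rh)
    (sweepf g z s).1
    (Conf i (tape_of (l ++ (sweepf g z s).2)) (size l + size s)%N rt rh)
    (size s).+1.
Proof.
elim: s z l => [|a s IHs] z l /=.
  rewrite cats0 addn0; apply: run_loop_exit; apply: run_act.
    by rewrite /= tape_of_end.
  by rewrite /perform /= ?write_blank ?write_same !GRing.addr0.
rewrite -[X in run _ _ _ _ _ _ X]add1n; apply: run_loop.
  apply: run_act; first by rewrite /= tape_of_mid.
  by rewrite /perform /= write_mid !write_same !GRing.addr0.
case: (g z a) => z1 a' /=.
have := IHs z1 (rcons l a'); case: sweepf => z2 s' /=.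
by rewrite !cat_rcons size_rcons addSnnS addz1.
Qed.

Lemma run_sweep Z (g : Z -> T -> Z * T) z i s rt rh :
  run w (sweep g) z (Conf i (tape_of s) 0%R rt rh)
    (sweepf g z s).1 (Conf i (tape_of (sweepf g z s).2) 0%R rt rh)
    (2 * size s + 3).
Proof.
have -> : 2 * size s + 3 = (size s).+1 + (size s).+2 by lia.
apply: run_seqf; first exact: (run_sweep_loop g z i [::] s rt rh).
by apply: run_rewind_col; rewrite size_sweepf.
Qed.

Definition copy_loop : flow T unit unit :=
  loop (act (fun z _ b r =>
    if b is Some a
    then (inl tt, Action Stay b MoveRight b MoveRight)
    else (inr tt, Action Stay b Stay r Stay))).

Definition copy : flow T unit unit :=
  seqf copy_loop (seqf (rewind unit HCol) (rewind unit HRow)).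

Lemma run_copy_loop i l s r : size s = size r ->
  run w copy_loop tt
    (Conf i (tape_of (l ++ s)) (size l) (tape_of (l ++ r)) (size l))
    tt (Conf i (tape_of (l ++ s)) (size l + size s)%N
             (tape_of (l ++ s)) (size l + size s)%N)
    (size s).+1.
Proof.
elim: s r l => [|a s IHs] [|b r] //= l => [_|[eq_size]].
  rewrite !cats0 addn0; apply: run_loop_exit; apply: run_act.
    by rewrite /= tape_of_end.
  by rewrite /perform /= ?write_blank ?write_same !GRing.addr0.
rewrite -[X in run _ _ _ _ _ _ X]add1n; apply: run_loop.
  apply: run_act; first by rewrite /= tape_of_mid.
  by rewrite /perform /= !write_mid GRing.addr0.
have := IHs r (rcons l a) eq_size.
by rewrite !cat_rcons size_rcons addSnnS addz1.
Qed.

Lemma run_copy i s r : size s = size r ->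
  run w copy tt (Conf i (tape_of s) 0%R (tape_of r) 0%R)
    tt (Conf i (tape_of s) 0%R (tape_of s) 0%R) (3 * size s + 5).
Proof.
move=> eq_size.
have -> : 3 * size s + 5 = (size s).+1 + ((size s).+2 + (size s).+2) by lia.
apply: run_seqf; first exact: (@run_copy_loop i [::] s r).
by apply: run_seqf; [apply: run_rewind_col | apply: run_rewind_row].
Qed.

(** Both branches move right, so the head also crosses the separator and stops on the first entry of
    the matrix. *)
Definition seek Z : flow T Z Z :=
  loop (act (fun z a b r =>
    if a == Some true then (inl z, shift_head HInput MoveRight b r)
    else (inr z, shift_head HInput MoveRight b r))).

Lemma run_seek Z (z : Z) n k v ct ch rt rh : w = nseq n true ++ false :: v ->
  k <= n ->
  run w (seek Z) z (Conf k ct ch rt rh) z (Conf n.+1 ct ch rt rh) (n - k).+1.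
Proof.
move=> wE le_kn; move eq_m : (n - k) => m; elim: m k le_kn eq_m => [|m IHm] k le_kn eq_m.
  have -> : k = n by lia.
  have wn : tape_of w n = Some false.
    by rewrite wE -{2}(size_nseq n true) tape_of_mid.
  apply: run_loop_exit; apply: run_act; first by rewrite /= wn.
  by rewrite /perform /= ?write_blank ?write_same !GRing.addr0 addz1.
rewrite -[X in run _ _ _ _ _ _ X]add1n; apply: run_loop; last by apply: (IHm k.+1); lia.
have wk : tape_of w k = Some true.
  rewrite wE /tape_of (nth_map false) ?nth_cat ?size_cat ?size_nseq /=; last lia.
  have -> : k < n by lia.
  by rewrite nth_nseq; case: ifP => //; lia.
apply: run_act; first by rewrite /= wk.
by rewrite /perform /= ?write_blank ?write_same !GRing.addr0 addz1.
Qed.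

Fixpoint rowf Z (f : Z -> T -> T -> bool -> Z * T) (a : T) z (bs : seq bool) s :=
  match bs, s with
  | b :: bs', t :: s' =>
      let: (z1, t') := f z a t b in
      let: (z2, s'') := rowf f a z1 bs' s' in (z2, t' :: s'')
  | _, _ => (z, [::])
  end.

Lemma size_rowf Z (f : Z -> T -> T -> bool -> Z * T) a z bs s : size bs = size s ->
  size (rowf f a z bs s).2 = size s.
Proof.
elim: bs s z => [|b bs IHbs] [|t s] z //= [eq_size].
by case: (f z a t b) => z1 t'; case: rowf (IHbs s z1 eq_size) => z2 s'' /= ->.
Qed.

(** The matrix has no separators between rows: the blank that ends the column tape is what signals
    the end of a row. *)
Definition row_loop Z (f : Z -> T -> T -> bool -> Z * T) : flow T Z Z :=
  loop (act (fun z i b r =>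
    match i, b, r with
    | Some e, Some t, Some a =>
        (inl (f z a t e).1, Action MoveRight (Some (f z a t e).2) MoveRight r Stay)
    | _, _, _ => (inr z, Action Stay b Stay r Stay)
    end)).

Lemma run_row_loop Z (f : Z -> T -> T -> bool -> Z * T) z u bs v l s a rt rh :
  w = u ++ bs ++ v -> size bs = size s -> rt rh = Some a ->
  run w (row_loop f) z (Conf (size u) (tape_of (l ++ s)) (size l) rt rh)
    (rowf f a z bs s).1
    (Conf (size u + size bs)%N (tape_of (l ++ (rowf f a z bs s).2))
          (size l + size s)%N rt rh)
    (size s).+1.
Proof.
move=> + + rta; elim: bs s z u l => [|b bs IHbs] [|t s] //= z u l wE => [_|[eq_size]].
  rewrite cats0 !addn0; apply: run_loop_exit; apply: run_act.
    by rewrite /= tape_of_end; case: tape_of.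
  by rewrite /perform /= ?write_blank ?write_same !GRing.addr0.
rewrite -[X in run _ _ _ _ _ _ X]add1n; apply: run_loop.
  apply: run_act; first by rewrite /= {1}wE !tape_of_mid rta.
  by rewrite /perform /= write_mid -rta write_same GRing.addr0 !addz1.
case E: (f z a t b) => [z1 t'] /=.
have := IHbs s z1 (rcons u b) (rcons l t'); case: rowf => z2 s' /=.
by rewrite !cat_rcons !size_rcons !addSnnS; apply.
Qed.

(* Row [x] of the matrix is scanned together with the column tape [s], while the
   head of the row tape rests on the symbol of [x]. The row tape [r] is a copy of
   the column tape made before the scan, so it does not see the updates of [s];
   [e] resets the state between rows. *)
Fixpoint passf Z (f : Z -> T -> T -> bool -> Z * T) (e : Z -> Z) z
    (rows : seq (seq bool)) r s :=
  match rows, r with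
  | bs :: rows', a :: r' =>
      let: (z1, s1) := rowf f a z bs s in passf f e (e z1) rows' r' s1
  | _, _ => (z, s)
  end.

(** Only the column head returns; the input head already stands on the first entry of the next
    row. *)
Definition row_pass Z (f : Z -> T -> T -> bool -> Z * T) (e : Z -> Z) : flow T Z Z :=
  seqf (row_loop f) (seqf (rewind Z HCol)
    (act (fun z _ b r => (e z, shift_head HRow MoveRight b r)))).

Definition rows_loop Z (f : Z -> T -> T -> bool -> Z * T) (e : Z -> Z) : flow T Z Z :=
  loop (bindl
    (act (fun z _ b r =>
       (if r == None then inr (inr z) else inl z, Action Stay b Stay r Stay)))
    (dimap id inl (row_pass f e))).

Definition pass Z (f : Z -> T -> T -> bool -> Z * T) (e : Z -> Z) (z : Z)
    : flow T unit Z :=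
  seqf copy (seqf (dimap (fun _ => z) id (seek Z)) (seqf (rows_loop f e)
    (seqf (rewind Z HRow) (rewind Z HInput)))).

Lemma run_row_pass Z (f : Z -> T -> T -> bool -> Z * T) e z u bs v s a (rh : nat)
    (rt : int -> option T) :
  w = u ++ bs ++ v -> size bs = size s -> rt rh = Some a ->
  run w (row_pass f e) z (Conf (size u) (tape_of s) 0%R rt rh)
    (e (rowf f a z bs s).1)
    (Conf (size u + size bs)%N (tape_of (rowf f a z bs s).2) 0%R rt rh.+1)
    (2 * size s + 4).
Proof.
move=> wE eq_size rta.
have -> : 2 * size s + 4 = (size s).+1 + ((size s).+2 + 1) by lia.
apply: run_seqf; first exact: (@run_row_loop _ f z u bs v [::] s a rt rh).
apply: run_seqf; first by apply: run_rewind_col; rewrite size_rowf.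
apply: run_act => //.
by rewrite /perform /= ?write_blank ?write_same !GRing.addr0 addz1.
Qed.

Lemma run_rows_loop Z (f : Z -> T -> T -> bool -> Z * T) e z u rows v s l r :
  w = u ++ flatten rows ++ v -> {in rows, forall bs, size bs = size s} ->
  size rows = size r ->
  run w (rows_loop f e) z (Conf (size u) (tape_of s) 0%R (tape_of (l ++ r)) (size l))
    (passf f e z rows r s).1
    (Conf (size u + size (flatten rows))%N (tape_of (passf f e z rows r s).2) 0%R
          (tape_of (l ++ r)) (size l + size r)%N)
    (size r * (2 * size s + 5) + 1).
Proof.
elim: rows r z u s l => [|bs rows IHrows] [|a r] //= z u s l wE szr => [_|[eq_size]].
  rewrite cats0 !addn0; apply: run_loop_exit; apply: run_bindl_exit; apply: run_act.
    by rewrite /= tape_of_end.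
  by rewrite /perform /= ?write_blank ?write_same !GRing.addr0.
have szbs := szr bs (mem_head _ _).
have -> : (size r).+1 * (2 * size s + 5) + 1
  = (1 + (2 * size s + 4)) + (size r * (2 * size s + 5) + 1) by lia.
apply: run_loop.
  apply: run_bindl.
    apply: run_act; first by rewrite /= tape_of_mid.
    by rewrite /perform /= write_mid write_same !GRing.addr0.
  apply: run_dimap; apply: (@run_row_pass _ f e z u bs (flatten rows ++ v) s a) => //.
    by rewrite wE /= -catA.
  exact: tape_of_mid.
have := size_rowf f a z szbs; case: rowf => z1 s1 /= eq_s1.
have := IHrows r (e z1) (u ++ bs) s1 (rcons l a).
rewrite eq_s1 size_cat size_rcons !cat_rcons -!catA addSnnS -addnA size_cat.
apply=> //; first by rewrite wE /= -catA.
move=> bs' in_bs'.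
by apply: szr; rewrite inE in_bs' orbT.
Qed.

Lemma run_pass Z (f : Z -> T -> T -> bool -> Z * T) e z rows s r :
  let n := size s in
  w = nseq n true ++ false :: flatten rows ->
  size rows = n -> {in rows, forall bs, size bs = n} -> size r = n ->
  let p := passf f e z rows s s in
  run w (pass f e z) tt (Conf 0%R (tape_of s) 0%R (tape_of r) 0%R)
    p.1 (Conf 0%R (tape_of p.2) 0%R (tape_of s) 0%R) (20 * (n + 1) ^ 2).
Proof.
move=> n wE szrows szr eq_r p.
have szfl : size (flatten rows) = n * n.
  rewrite size_flatten /shape -{1}szrows.
  elim: (rows) szr => //= bs rows' IH szr'; rewrite IH ?szr' ?mem_head //.
  by move=> bs' in_bs'; apply: szr'; rewrite inE in_bs' orbT.
have szw : size w = n + (n * n).+1 by rewrite wE size_cat size_nseq /= szfl.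
(* The summands are the costs of copying, reaching the matrix, scanning the [n] rows, and rewinding
   the row tape and the input of length [n + n * n + 1]. *)
apply: (@run_weaken _ _ _ _ _ _ _ _ _ ((3 * n + 5) + ((n - 0).+1 +
  ((n * (2 * n + 5) + 1) + (n.+2 + (n.+1 + n * n).+2))))); first by nia.
apply: run_seqf; first by apply: run_copy.
apply: run_seqf; first by apply: run_dimap; apply: (run_seek z _ _ _ _ wE).
have wE' : w = (nseq n true ++ [:: false]) ++ flatten rows ++ [::].
  by rewrite wE cats0 -catA.
have szu : size (nseq n true ++ [:: false]) = n.+1 by rewrite size_cat size_nseq addn1.
apply: run_seqf.
  have := @run_rows_loop _ f e z _ rows _ s [::] s wE' szr szrows.
  by rewrite szu szfl; apply.
apply: run_seqf; first by apply: run_rewind_row.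
by apply: run_rewind_input; lia.
Qed.

(** The unary prefix of the encoding serves as the yardstick for laying out one cell per vertex on
    each work tape. *)
Definition init_loop (t0 : T) : flow T unit unit :=
  loop (act (fun z a b r =>
    if a == Some true
    then (inl z, Action MoveRight (Some t0) MoveRight (Some t0) MoveRight)
    else (inr z, Action Stay b Stay r Stay))).

Definition initialize (t0 : T) : flow T unit unit :=
  seqf (init_loop t0)
    (seqf (rewind unit HInput) (seqf (rewind unit HCol) (rewind unit HRow))).

Lemma run_init_loop t0 n m v : w = nseq n true ++ false :: v -> m <= n ->
  let t := tape_of (nseq (n - m) t0) in
  run w (init_loop t0) tt (Conf (n - m)%N t (n - m)%N t (n - m)%N) tt
    (Conf n (tape_of (nseq n t0)) n (tape_of (nseq n t0)) n) m.+1.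
Proof.
move=> wE; elim: m => [|m IHm] le_mn t; rewrite {}/t.
  rewrite subn0; apply: run_loop_exit; apply: run_act.
    by rewrite /= wE -{2}(size_nseq n true) tape_of_mid.
  by rewrite /perform /= ?write_blank ?write_same !GRing.addr0.
rewrite -[X in run _ _ _ _ _ _ X]add1n; apply: run_loop; last by apply: IHm; lia.
have wk : tape_of w (n - m.+1)%N = Some true.
  rewrite wE /tape_of (nth_map false) ?nth_cat ?size_cat ?size_nseq /=; last lia.
  have -> : n - m.+1 < n by lia.
  by rewrite nth_nseq; case: ifP => //; lia.
apply: run_act; first by rewrite /= wk.
rewrite /perform /= -{3 6}(size_nseq (n - m.+1) t0) !write_end.
have -> : n - m = (n - m.+1).+1 by lia.
have -> : rcons (nseq (n - m.+1) t0) t0 = nseq (n - m.+1).+1 t0.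
  by rewrite -cats1 -[[:: t0]]/(nseq 1 t0) -nseqD addn1.
by rewrite addz1.
Qed.

Lemma run_initialize t0 n v : w = nseq n true ++ false :: v ->
  run w (initialize t0) tt (Conf 0%R (fun=> None) 0%R (fun=> None) 0%R) tt
    (Conf 0%R (tape_of (nseq n t0)) 0%R (tape_of (nseq n t0)) 0%R) (4 * n + 7).
Proof.
move=> wE.
have -> : 4 * n + 7 = n.+1 + (n.+2 + (n.+2 + n.+2)) by lia.
apply: run_seqf.
  have := run_init_loop t0 wE (leqnn n); rewrite subnn /=.
  have -> : tape_of [::] = (fun=> @None T); last exact.
  by apply: functional_extensionality => -[[]|].
apply: run_seqf; first by apply: run_rewind_input; rewrite wE size_cat size_nseq leq_addr.
apply: run_seqf; first by apply: run_rewind_col; rewrite size_nseq.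
by apply: run_rewind_row; rewrite size_nseq.
Qed.

End Primitives.
Lemma sweepf_cat (T Z : finType) (g : Z -> T -> Z * T) z s1 s2 :
  sweepf g z (s1 ++ s2) =
  ((sweepf g (sweepf g z s1).1 s2).1,
   (sweepf g z s1).2 ++ (sweepf g (sweepf g z s1).1 s2).2).
Proof.
elim: s1 z => [|a s1 IHs] z /=; first by case: sweepf.
by case: (g z a) => z1 a'; rewrite IHs; case: (sweepf g z1 s1).
Qed.

Lemma sweepf_map (T Z : finType) (h : T -> T) (z : Z) s :
  sweepf (fun z t => (z, h t)) z s = (z, map h s).
Proof. by elim: s => //= a s ->. Qed.

Lemma sweepf_all (T : finType) (p : T -> bool) z s :
  sweepf (fun z t => (z && p t, t)) z s = (z && all p s, s).
Proof. by elim: s z => [|a s IHs] z /=; rewrite ?andbT // IHs andbA. Qed.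

Lemma sweepf_fixed (T Z : finType) (g : Z -> T -> Z * T) z s :
  {in s, forall t, g z t = (z, t)} -> sweepf g z s = (z, s).
Proof.
elim: s => //= a s IHs gE; rewrite gE ?mem_head // IHs // => t in_t.
by apply: gE; rewrite inE in_t orbT.
Qed.

(** * Exhaustive search by moving marks *)

Section Search.
Variables (J : finType) (G : sgraph).
Notation T := (bool * {set J})%type.
Notation w := (encode G).
Notation n := #|G|.
Implicit Types (a : J -> option G) (C : G -> bool) (j : J) (js : seq J).

(* Track [j] marks the vertex [a j], or none. *)
Definition marks a (x : G) : {set J} := [set j | a j == Some x].

Lemma in_marks a j x : (j \in marks a x) = (a j == Some x).
Proof. by rewrite inE. Qed.

(** The Boolean is a scratch colour. The order [enum G] is that of the encoding, so the cells line
    up with the entries of every matrix row. *)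
Definition cells C a : seq T := [seq (C x, marks a x) | x <- enum G].

Lemma size_cells C a : size (cells C a) = n.
Proof. by rewrite size_map cardE. Qed.

Definition home (s r : seq T) : conf T := Conf 0%R (tape_of s) 0%R (tape_of r) 0%R.

Definition place a j o : J -> option G := fun i => if i == j then o else a i.

Definition agree_off js a a' := forall i, i \notin js -> a' i = a i.

(* The tracks in [js] are free for [m]; on failure they are left empty again, so
   that [m] can be the body of an outer loop. *)
Definition searches (m : flow T unit bool) js (P : (J -> option G) -> bool) t :=
  forall a C r, (forall j, j \in js -> a j = None) -> size r = n ->
  exists b c', run w m tt (home (cells C a) r) b c' t /\
    if b then exists2 a', agree_off js a a' & P a'
    else (exists C' r', c' = home (cells C' a) r' /\ size r' = n) /\
         forall a', agree_off js a a' -> ~~ P a'.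

Lemma searches_weaken m js P t t' : t <= t' ->
  searches m js P t -> searches m js P t'.
Proof.
move=> le_tt' sm a C r aN szr; have [b [c' [rm Pm]]] := sm a C r aN szr.
by exists b, c'; split=> //; apply: run_weaken rm.
Qed.

Definition unmarked j (z : bool) (t : T) := (z && (j \notin t.2), t).

(** The state is [true] when a mark is being carried: it is picked up from its cell and dropped on
    the next one. A final [true] means that it fell off the right end. *)
Definition move_mark j (z : bool) (t : T) : bool * T :=
  if j \in t.2 then (true, (t.1, t.2 :\ j))
  else (false, if z then (t.1, j |: t.2) else t).

(** The first sweep finds out whether track [j] is empty; if so, the second starts by carrying a
    mark and drops it on the first vertex. *)
Definition advance j : flow T unit bool :=
  seqf (dimap (fun=> true) id (sweep (unmarked j))) (sweep (move_mark j)).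

Definition found (b : bool) : unit + (unit + bool) :=
  if b then inr (inr true) else inl tt.

Definition exhausted (z : bool) : unit + bool := if z then inr false else inl tt.

Definition for_vertex j (body : flow T unit bool) : flow T unit bool :=
  loop (bindl (dimap id found body) (dimap id exhausted (advance j))).

(** The split is the loop counter: [E1] ends with the marked vertex, or is empty if there is no mark
    yet, and [ohead E2] is the next position, [None] once the vertices run out. *)
Lemma move_markE j C a E1 E2 : enum G = E1 ++ E2 -> a j = last None (map Some E1) ->
  sweepf (move_mark j) (E1 == [::]) (cells C a)
  = (E2 == [::], cells C (place a j (ohead E2))).
Proof.
rewrite /cells => enumE aj; have := enum_uniq G; rewrite enumE => uniqE.
set v := ohead E2.
have markE x i : (i \in marks (place a j v) x) =
    if i == j then v == Some x else a i == Some x.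
  by rewrite in_marks /place; case: (i == j).
(* Cells carrying neither the old nor the new mark are left alone. *)
have sweep_skip E : {in E, forall x, (a j != Some x) && (v != Some x)} ->
    sweepf (move_mark j) false [seq (C x, marks a x) | x <- E]
    = (false, [seq (C x, marks (place a j v) x) | x <- E]).
  move=> skipE; rewrite sweepf_fixed => [|_ /mapP[x xE ->]]; last first.
    by rewrite /move_mark /= in_marks; case/andP: (skipE x xE) => /negbTE->.
  congr (_, _); apply/eq_in_map => x xE; congr (_, _); apply/setP => i.
  rewrite markE in_marks; case: (i =P j) => // ->.
  by case/andP: (skipE x xE) => /negbTE-> /negbTE->.
(* Here the mark is being carried: the head of [E2] receives it, or it is dropped from the tape if
   [E2] is empty. *)
have sweep_next : {in E2, forall x, a j != Some x} ->
    sweepf (move_mark j) true [seq (C x, marks a x) | x <- E2]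
    = (E2 == [::], [seq (C x, marks (place a j v) x) | x <- E2]).
  have := cat_uniq E1 E2; rewrite uniqE => /esym/and3P[_ _].
  move: markE sweep_skip; rewrite /v {v}.
  case: E2 {enumE uniqE} => //= x E markE sweep_skip.
  case/andP=> xE _ ajE; rewrite {1}/move_mark /= in_marks.
  rewrite (negbTE (ajE x (mem_head _ _))) sweep_skip => [|z zE].
    congr (_, (_, _) :: _); apply/setP => i.
    by rewrite markE !inE; case: (i =P j) => //= _; rewrite eqxx.
  rewrite ajE ?inE ?zE ?orbT //=.
  by apply: contraNneq xE => -[->].
case/lastP: E1 => [|E1 y] in enumE aj uniqE sweep_next *.
  by apply: sweep_next => x _; rewrite aj.
rewrite map_rcons last_rcons in aj.
move: uniqE; rewrite cat_uniq rcons_uniq => /and3P[/andP[yE1 _] nE12 uE2].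
have yE2 : y \notin E2.
  by apply: contra nE12 => yE2; apply/hasP; exists y; rewrite ?mem_rcons ?mem_head.
have vE1 x : x \in rcons E1 y -> v != Some x.
  rewrite /v; case: E2 nE12 {enumE uE2 yE2 sweep_next markE sweep_skip v} => //= z E2.
  by rewrite negb_or => /andP[zE1 _] xE1; apply: contraNneq zE1 => -[->].
rewrite -size_eq0 size_rcons !map_cat sweepf_cat map_rcons -!cats1 sweepf_cat.
rewrite sweep_skip /=; last first.
  move=> x xE1; rewrite aj vE1 ?mem_rcons ?inE ?xE1 ?orbT // andbT.
  by apply: contraNneq yE1 => -[->].
rewrite /move_mark /= in_marks aj eqxx /=.
rewrite -/(move_mark j) sweep_next => [/=|x xE2]; last first.
  by rewrite aj; apply: contraNneq yE2 => -[->].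
rewrite map_cat; congr (_, (_ ++ [:: (_, _)]) ++ _).
apply/setP => i; rewrite markE !inE; case: (i =P j) => [->|//] /=.
by rewrite (negbTE (vE1 _ _)) ?mem_rcons ?mem_head.
Qed.

Lemma run_advance j C a r E1 E2 :
  enum G = E1 ++ E2 -> a j = last None (map Some E1) ->
  run w (advance j) tt (home (cells C a) r)
    (E2 == [::]) (home (cells C (place a j (ohead E2))) r) (4 * n + 6).
Proof.
move=> enumE aj; have -> : 4 * n + 6 = (2 * n + 3) + (2 * n + 3) by lia.
have unE : sweepf (unmarked j) true (cells C a) = (E1 == [::], cells C a).
  rewrite sweepf_all; congr (_, _); rewrite /cells all_map /=.
  case/lastP: E1 => [|E1 y] in enumE aj *.
    by rewrite enumE; apply/allP => x _; rewrite /= in_marks aj.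
  rewrite map_rcons last_rcons in aj; rewrite -size_eq0 size_rcons.
  apply/allP => /(_ y); rewrite enumE mem_cat mem_rcons mem_head /= in_marks aj eqxx.
  by move/(_ isT).
apply: run_seqf.
  apply: run_dimap; rewrite -{1}(size_cells C a); exact: run_sweep.
have := run_sweep w (move_mark j) (E1 == [::]) 0%R (cells C a) (tape_of r) 0%R.
by rewrite unE (move_markE _ enumE) //= size_cells.
Qed.

(** Track [j] runs through [None] and then all vertices, which makes [n.+1] rounds of the body and
    one advance. The last advance pushes the mark off the tape, which leaves the track empty as
    required for an outer loop. *)
Lemma searches_for_vertex j js body P t : j \notin js -> searches body js P t ->
  searches (for_vertex j body) (j :: js) P (n.+1 * (t + (4 * n + 6))).
Proof.
move=> j_js sbody a C r aN szr; set u := t + _.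
have a_j : a j = None by apply: aN; rewrite mem_head.
have aN' o i : i \in js -> place a j o i = None.
  move=> i_js; rewrite /place; case: eqP => [ij|_]; first by rewrite -ij i_js in j_js.
  by apply: aN; rewrite inE i_js orbT.
have aE : place a j None = a.
  by apply: functional_extensionality => i; rewrite /place; case: eqP => // ->.
have agree_place o a' : agree_off js (place a j o) a' -> agree_off (j :: js) a a'.
  move=> agr i; rewrite inE negb_or => /andP[ij i_js].
  by rewrite agr // /place (negbTE ij).
(* Induction on the vertices [E2] still to come; the values left to test are the current one and
   those in [E2]. For [E1] empty these are all values of [a' j]. *)
suff: forall E2 E1 C r, enum G = E1 ++ E2 -> size r = n ->
  exists b c', run w (for_vertex j body) tt
      (home (cells C (place a j (last None (map Some E1)))) r) b c' ((size E2).+1 * u) /\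
    if b then exists2 a', agree_off (j :: js) a a' & P a'
    else (exists C' r', c' = home (cells C' a) r' /\ size r' = n) /\
         forall a', agree_off (j :: js) a a' ->
           a' j \in last None (map Some E1) :: map Some E2 -> ~~ P a'.
  move=> /(_ (enum G) [::] C r erefl szr) [b [c' [+ Pb]]].
  rewrite aE -cardE => rb; exists b, c'; split=> //; case: b Pb {rb} => // -[? Pa'].
  split=> // a' agr; apply: Pa' => //; case: (a' j) => [x|]; last by rewrite mem_head.
  by rewrite inE map_f ?mem_enum.
elim=> [|x E2 IHE] E1 {}C {}r enumE {}szr.
all: set o := last None (map Some E1).
all: have [[] [c1 [r1 P1]]] := sbody (place a j o) C r (aN' o) szr.
1,3: exists true, c1; split; last by [case: P1 => a' /agree_place; exists a'].
1,2: apply: run_loop_exit; apply: run_bindl_exit.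
1,2: apply: (run_weaken _ (run_dimap (f := id) found r1)); rewrite /u /=; lia.
all: have {P1} [[C1 [r1' [c1E szr1']]] P1] := P1.
all: have plo : place a j o j = last None (map Some E1) by rewrite /place eqxx.
all: have adv := run_advance C1 r1' enumE plo; rewrite /= -c1E in adv.
all: have plE o' : place (place a j o) j o' = place a j o' by
  apply: functional_extensionality => i; rewrite /place; case: eqP.
- have agrN a' : agree_off [:: j & js] a a' -> a' j \in [:: o] -> ~~ P a'.
    move=> agr; rewrite inE => /eqP a'j; apply: P1 => i i_js; rewrite /place.
    by case: eqP => [->//|/eqP ij]; apply: agr; rewrite inE negb_or ij.
  rewrite plE aE in adv.
  exists false, (home (cells C1 a) r1'); split; last by split=> //; exists C1, r1'.
  rewrite mul1n; apply: run_loop_exit.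
  apply: run_bindl (run_dimap (f := id) exhausted adv).
  exact: (run_dimap (f := id) found r1).
rewrite plE in adv.
have [|b [c' [rl Pl]]] := IHE (rcons E1 x) C1 r1' _ szr1'.
  by rewrite cat_rcons.
rewrite map_rcons last_rcons in rl Pl.
exists b, c'; split.
  rewrite mulSn; apply: run_loop rl.
  apply: run_bindl (run_dimap (f := id) exhausted adv).
  exact: (run_dimap (f := id) found r1).
case: b Pl {rl} => // -[? Pl]; split=> // a' agr; rewrite inE => /orP[/eqP a'j|].
  apply: P1 => i i_js; rewrite /place.
  by case: eqP => [->//|/eqP ij]; apply: agr; rewrite inE negb_or ij.
exact: Pl.
Qed.

Definition search js leaf : flow T unit bool := foldr for_vertex leaf js.

(** Each nested loop multiplies the time by [n.+1]; its advances cost [4 * n + 6], at most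
    [6 * n.+1], which raises the coefficient by 6. *)
Lemma searches_search js leaf P c : uniq js ->
  searches leaf [::] P (c * n.+1 ^ 2) ->
  searches (search js leaf) js P ((c + 6 * size js) * n.+1 ^ (size js + 2)).
Proof.
move=> + sl; elim: js => [|j js IHjs] /=; first by rewrite muln0 addn0.
case/andP=> j_js /IHjs /(searches_for_vertex j_js); apply: searches_weaken.
have le1 : n.+1 <= n.+1 ^ (size js + 2) by rewrite addnS expnS leq_pmulr ?expn_gt0.
rewrite addSn expnS [leqRHS]mulnCA leq_mul2l; apply/orP; right.
by rewrite mulnS; move: (n.+1 ^ _) (6 * size js) le1 => q k; lia.
Qed.

End Search.
Lemma rowf_map (T Z : finType) (f : Z -> T -> T -> bool -> Z * T) r z
    (A : eqType) (E : seq A) (e : A -> bool) (phi : A -> T) (h : A -> T) :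
  (forall z x, f z r (phi x) (e x) = (z, h x)) ->
  rowf f r z (map e E) (map phi E) = (z, map h E).
Proof. by move=> fE; elim: E => //= x E IHE; rewrite fE IHE. Qed.

(** * The tests performed for each choice of marks *)

Section Leaves.
Variables (k m d : nat) (G : sgraph).
Notation J := ('I_k + 'I_m)%type.
Notation T := (bool * {set J})%type.
Notation n := #|G|.
Notation w := (encode G).
Notation E := (enum G).
Implicit Types (a : J -> option G) (C : G -> bool) (M : {set J}).

Definition in_base M := [exists i : 'I_k, inl i \in M].
Definition in_flip M := [exists i : 'I_m, inr i \in M].
(* The first [k] correction tracks double as the vertices exempt from domination:
   [adj] is irreflexive, so [covered] misses the members of a dominating set. *)
Definition in_rest M := [exists i : 'I_m, (i < k) && (inr i \in M)].

Definition covered a y := has (fun x => adj x y && in_base (marks a x)) E.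

Definition colour a y := covered a y (+) in_flip (marks a y).

Definition dcut_colouring C :=
  has (fun x => has (fun y => C x != C y) E) E &&
  ~~ has (fun x => d < count (fun y => adj x y && (C x != C y)) E) E.

Definition almost_dominating a := all (fun y => covered a y || in_rest (marks a y)) E.

(** The colour bits may still hold the result of the previous choice. *)
Definition clear : flow T unit unit := sweep (fun z t => (z, (false, t.2))).

Definition spread : flow T unit unit :=
  pass (fun z r t e => (z, (t.1 || e && in_base r.2, t.2))) id tt.

Definition flip : flow T unit unit :=
  sweep (fun z t => (z, (t.1 (+) in_flip t.2, t.2))).

(* The state records whether two colours occur, whether some vertex has more than
   [d] neighbours of the other colour, and their number for the current row. *)
Definition test_edge (z : bool * bool * 'I_d.+1) (r t : T) (e : bool) :=
  ((z.1.1 || (r.1 != t.1),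
    z.1.2 || [&& e, r.1 != t.1 & z.2 == d :> nat],
    if e && (r.1 != t.1) then inord (minn d z.2.+1) else z.2), t).

Definition test : flow T unit (bool * bool * 'I_d.+1) :=
  pass test_edge (fun z => (z.1, ord0)) (false, false, ord0).

Definition dcut_leaf : flow T unit bool :=
  seqf clear (seqf spread (seqf flip (dimap id (fun z => z.1.1 && ~~ z.1.2) test))).

Definition dominating_leaf : flow T unit bool :=
  seqf clear (seqf spread
    (dimap (fun=> true) id (sweep (fun z t => (z && (t.1 || in_rest t.2), t))))).

Definition rows : seq (seq bool) := [seq [seq adj x y | y <- E] | x <- E].

Lemma encodeE : w = nseq n true ++ false :: flatten rows.
Proof. by []. Qed.

Lemma size_rows : size rows = n.
Proof. by rewrite size_map cardE. Qed.

Lemma size_row : {in rows, forall bs, size bs = n}.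
Proof. by move=> _ /mapP[x _ ->]; rewrite size_map cardE. Qed.

Lemma run_clear C a r :
  run w clear tt (home (cells C a) r) tt (home (cells (fun=> false) a) r) (2 * n + 3).
Proof.
have := run_sweep w (fun (z : unit) (t : T) => (z, (false, t.2))) tt 0%R
  (cells C a) (tape_of r) 0%R.
by rewrite sweepf_map size_cells -map_comp.
Qed.

Lemma run_flip C a r :
  run w flip tt (home (cells C a) r) tt
    (home (cells (fun y => C y (+) in_flip (marks a y)) a) r) (2 * n + 3).
Proof.
have := run_sweep w (fun (z : unit) (t : T) => (z, (t.1 (+) in_flip t.2, t.2))) tt
  0%R (cells C a) (tape_of r) 0%R.
by rewrite sweepf_map size_cells -map_comp.
Qed.

Lemma run_pass_cells (Z : finType) (f : Z -> T -> T -> bool -> Z * T) e z C a r :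
  size r = n ->
  let p := passf f e z rows (cells C a) (cells C a) in
  run w (pass f e z) tt (home (cells C a) r) p.1 (home p.2 (cells C a))
    (20 * n.+1 ^ 2).
Proof.
move=> szr; rewrite -[n.+1]addn1 -(size_cells C a).
by apply: run_pass; rewrite ?size_cells ?size_rows //; apply: size_row.
Qed.

Lemma run_spread a r : size r = n ->
  exists2 r', size r' = n &
  run w spread tt (home (cells (fun=> false) a) r)
    tt (home (cells (covered a) a) r') (20 * n.+1 ^ 2).
Proof.
move=> szr; exists (cells (fun=> false) a); first exact: size_cells.
rewrite (_ : cells (covered a) a = (passf (fun (z : unit) (r t : T) e =>
  (z, (t.1 || e && in_base r.2, t.2))) id tt rows (cells (fun=> false) a)
  (cells (fun=> false) a)).2); last first.
  rewrite /rows {2}/cells.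
  (* For the induction, [X] is the list of rows still to be scanned and [C] the colouring
     accumulated by the earlier rows. *)
  suff passE X C : (passf (fun (z : unit) (r t : T) e =>
      (z, (t.1 || e && in_base r.2, t.2))) id tt [seq [seq adj x y | y <- E] | x <- X]
      [seq (false, marks a x) | x <- X] (cells C a)).2
      = cells (fun y => C y || has (fun x => adj x y && in_base (marks a x)) X) a.
    by rewrite passE.
  elim: X C => [|x X IHX] C /=.
    by congr cells; apply: functional_extensionality => y; rewrite orbF.
  rewrite (@rowf_map _ _ _ _ _ _ E _ _
    (fun y => (C y || adj x y && in_base (marks a x), marks a y))) //.
  rewrite -/(cells (fun y => C y || adj x y && in_base (marks a x)) a) IHX.
  by congr cells; apply: functional_extensionality => y; rewrite orbA.
have := run_pass_cells (fun (z : unit) (r t : T) e =>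
  (z, (t.1 || e && in_base r.2, t.2))) id tt (fun=> false) a szr.
by move=> /=; case: (passf _ _ _ _ _ _) => -[].
Qed.

Lemma run_test C a r : size r = n -> exists2 z : bool * bool * 'I_d.+1,
  z.1.1 && ~~ z.1.2 = dcut_colouring C &
  run w test tt (home (cells C a) r) z (home (cells C a) (cells C a)) (20 * n.+1 ^ 2).
Proof.
move=> szr; set D := fun x y => C x != C y.
(* The counter saturates at [d], and the flag is raised by a bichromatic edge met at saturation; so
   the flag still reflects the true count exceeding [d]. *)
have rowE (z : bool * bool * 'I_d.+1) x Y :
    rowf test_edge (C x, marks a x) z [seq adj x y | y <- Y]
      [seq (C y, marks a y) | y <- Y] =
    ((z.1.1 || has (D x) Y,
      z.1.2 || (d < z.2 + count (fun y => adj x y && D x y) Y),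
      inord (minn d (z.2 + count (fun y => adj x y && D x y) Y))),
     [seq (C y, marks a y) | y <- Y]).
  elim: Y z => [|y Y IHY] [[z1 z2] c] /=.
    have lec := ltn_ord c; rewrite orbF addn0 ltnNge -ltnS lec orbF.
    by rewrite (minn_idPr _) ?inord_val.
  rewrite IHY /= -/(D x y) orbA; congr ((_, _, _), _).
    rewrite -orbA; congr orb; case: (adj x y) => //=; case: (D x y) => //=.
    have := ltn_ord c; rewrite inordK ?ltnS ?geq_minl //.
    move: (count _ _) => q; case: eqP => /=; lia.
  case: (adj x y) => //=; case: (D x y) => //=; congr inord.
  have := ltn_ord c; rewrite inordK ?ltnS ?geq_minl //.
  move: (count _ _) => q; lia.
have passE X (z : bool * bool) :
    passf test_edge (fun z => (z.1, ord0)) (z, ord0)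
      [seq [seq adj x y | y <- E] | x <- X] [seq (C x, marks a x) | x <- X] (cells C a)
    = ((z.1 || has (fun x => has (D x) E) X,
        z.2 || has (fun x => d < count (fun y => adj x y && D x y) E) X, ord0),
       cells C a).
  elim: X z => [|x X IHX] [z1 z2] /=; first by rewrite !orbF.
  by rewrite rowE /= IHX /= !orbA.
have := run_pass_cells test_edge (fun z => (z.1, ord0)) (false, false, ord0) C a szr.
rewrite /rows {2}/cells passE => runE.
by eexists; last exact: runE.
Qed.

Lemma searches_dcut_leaf :
  searches dcut_leaf [::] (fun a => dcut_colouring (colour a)) (50 * n.+1 ^ 2).
Proof.
move=> a C r _ szr.
have [r1 szr1 run1] := run_spread a szr.
have [z zE run2] := run_test (colour a) a szr1.
have runl := run_seqf (run_clear C a r) (run_seqf run1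
  (run_seqf (run_flip (covered a) a r1)
    (run_dimap (f := id) (fun z => z.1.1 && ~~ z.1.2) run2))).
exists (dcut_colouring (colour a)), (home (cells (colour a) a) (cells (colour a) a)).
(* Two passes cost [40 * n.+1 ^ 2]; the two linear sweeps fit into the remaining [10 * n.+1 ^ 2]. *)
split; first by rewrite -zE; apply: run_weaken runl; nia.
have eqa a' : agree_off [::] a a' -> a' = a.
  by move=> agr; apply: functional_extensionality => i; apply: agr.
case: ifP => [Pa|/negbT Pa]; first by exists a.
split; last by move=> a' /eqa->.
by do 2!eexists; split; [reflexivity | rewrite size_cells].
Qed.

Lemma searches_dominating_leaf :
  searches dominating_leaf [::] almost_dominating (50 * n.+1 ^ 2).
Proof.
move=> a C r _ szr.
have [r1 szr1 run1] := run_spread a szr.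
have run2 : run w (sweep (fun z (t : T) => (z && (t.1 || in_rest t.2), t))) true
    (home (cells (covered a) a) r1) (almost_dominating a)
    (home (cells (covered a) a) r1) (2 * n + 3).
  have := run_sweep w (fun z (t : T) => (z && (t.1 || in_rest t.2), t)) true 0%R
    (cells (covered a) a) (tape_of r1) 0%R.
  by rewrite sweepf_all size_cells all_map.
have runl := run_seqf (run_clear C a r) (run_seqf run1
  (run_dimap (f := fun=> true) id run2)).
exists (almost_dominating a), (home (cells (covered a) a) r1).
split; first by apply: run_weaken runl; nia.
have eqa a' : agree_off [::] a a' -> a' = a.
  by move=> agr; apply: functional_extensionality => i; apply: agr.
case: ifP => [Pa|/negbT Pa]; first by exists a.
split; last by move=> a' /eqa->.
by do 2!eexists; split; [reflexivity | exact: szr1].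
Qed.

End Leaves.
(** * Cuts and dominating sets *)

(** The cut is determined by the partition, and [R] is the complement of [B]; so a colouring by
    Booleans that uses both colours carries the same data. *)
Lemma has_dcut_colouring (d : nat) (G : sgraph) :
  has_dcut d G <-> exists C : G -> bool, dcut_colouring d C.
Proof.
have cross (C : G -> bool) x : count (fun y => adj x y && (C x != C y)) (enum G)
    = #|[set y | adj x y && (C x != C y)]|.
  by rewrite -size_filter enumT cardsE cardE.
split=> [[M _ [B [R [[B0 R0 disBR BR] [_ dB dR]]]]]|[C /andP[mixC /hasPn validC]]].
  have RE y : (y \in R) = (y \notin B).
    apply/idP/idP => [yR|yB]; first by rewrite (disjointFl disBR).
    by have := in_setT y; rewrite -BR inE (negbTE yB).
  pose C x := x \in B; exists C; apply/andP; split.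
    have [/set0Pn[x xB] /set0Pn[y yR]] := (B0, R0).
    apply/hasP; exists x; rewrite ?mem_enum //; apply/hasP; exists y.
      by rewrite mem_enum.
    by rewrite /C xB; move: yR; rewrite RE => /negbTE->.
  apply/hasPn => x _; rewrite -leqNgt cross; have [xB|xB] := boolP (x \in B).
    apply: leq_trans (dB x xB); apply/subset_leq_card/subsetP => y.
    by rewrite !inE RE /C xB => /andP[->]; case: (y \in B).
  have xR : x \in R by rewrite RE.
  apply: leq_trans (dR x xR); apply/subset_leq_card/subsetP => y.
  by rewrite !inE /C (negbTE xB) => /andP[->]; case: (y \in B).
set B := [set x | C x]; set R := [set x | ~~ C x].
have bound x : #|[set y | adj x y && (C x != C y)]| <= d.
  by rewrite leqNgt -cross; apply: validC; rewrite mem_enum.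
exists (edges_between B R); first by apply/subsetP => e; rewrite inE => /andP[].
exists B, R; split; split=> //.
- have [x _ /hasP[y _]] := hasP mixC; case Cx: (C x); case Cy: (C y) => // _.
    by apply/set0Pn; exists x; rewrite inE.
  by apply/set0Pn; exists y; rewrite inE.
- have [x _ /hasP[y _]] := hasP mixC; case Cx: (C x); case Cy: (C y) => // _.
    by apply/set0Pn; exists y; rewrite inE Cy.
  by apply/set0Pn; exists x; rewrite inE Cx.
- by rewrite disjoint_subset; apply/subsetP => x; rewrite !inE negbK.
- by apply/setP => x; rewrite !inE; case: (C x).
- move=> x; rewrite inE => Cx; apply: leq_trans (bound x).
  by apply/subset_leq_card/subsetP => y; rewrite !inE Cx => /andP[/negbTE-> ->].
move=> x; rewrite inE => /negbTE Cx; apply: leq_trans (bound x).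
by apply/subset_leq_card/subsetP => y; rewrite !inE Cx => /andP[-> ->].
Qed.

Section Domination.
Variables (k d : nat) (G : sgraph).
Notation m := (d.+1 * k).
Notation J := ('I_k + 'I_m)%type.
Implicit Types (a : J -> option G) (C : G -> bool) (S W : {set G}).

(** The sets are listed on the tracks in the order of [enum]; the default [None] leaves surplus
    tracks empty. *)
Definition guess S W : J -> option G := fun j =>
  match j with
  | inl i => nth None (map Some (enum S)) i
  | inr i => nth None (map Some (enum W)) i
  end.

Lemma nth_enum_set S x i :
  (nth None (map Some (enum S)) i == Some x) = (index x (enum S) == i) && (x \in S).
Proof.
have [lti|lei] := ltnP i (size (enum S)); last first.
  rewrite nth_default ?size_map //; case: (index x _ =P i) => //= ei.
  by rewrite -mem_enum -index_mem ei ltnNge lei.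
rewrite (nth_map x) //; apply/eqP/andP => [[<-]|[/eqP <- xS]].
  by rewrite index_uniq ?enum_uniq // -mem_enum mem_nth.
by rewrite nth_index ?mem_enum.
Qed.

Lemma index_enum_lt S x p : #|S| <= p -> x \in S -> index x (enum S) < p.
Proof. by move=> le_p xS; apply: leq_trans le_p; rewrite cardE index_mem mem_enum. Qed.

Lemma in_base_guess S W x : #|S| <= k ->
  in_base (marks (guess S W) x) = (x \in S).
Proof.
move=> leS; apply/existsP/idP => [[i]|xS].
  by rewrite in_marks /= nth_enum_set => /andP[].
exists (Ordinal (index_enum_lt leS xS)).
by rewrite in_marks /= nth_enum_set eqxx.
Qed.

Lemma in_flip_guess S W x : #|W| <= m ->
  in_flip (marks (guess S W) x) = (x \in W).
Proof.
move=> leW; apply/existsP/idP => [[i]|xW].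
  by rewrite in_marks /= nth_enum_set => /andP[].
exists (Ordinal (index_enum_lt leW xW)).
by rewrite in_marks /= nth_enum_set eqxx.
Qed.

Lemma in_rest_guess S W x : #|W| <= k -> x \in W ->
  in_rest (marks (guess S W) x).
Proof.
move=> leW xW; have leW' : #|W| <= m by rewrite mulSn; lia.
apply/existsP; exists (Ordinal (index_enum_lt leW' xW)).
by rewrite in_marks /= nth_enum_set eqxx xW (index_enum_lt leW xW).
Qed.

Lemma card_preim_Some W (s : seq (option G)) :
  {in W, forall x, Some x \in s} -> #|W| <= size s.
Proof.
move=> sW; rewrite cardE -(size_map Some); apply: uniq_leq_size.
  by rewrite map_inj_uniq ?enum_uniq // => x y [].
by move=> _ /mapP[x xW ->]; apply: sW; rewrite -mem_enum.
Qed.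

Lemma card_base a : #|[set x | in_base (marks a x)]| <= k.
Proof.
rewrite -[leqRHS](size_enum_ord k) -(size_map (a \o inl)); apply: card_preim_Some => x.
rewrite inE => /existsP[i]; rewrite in_marks => /eqP <-.
by apply: (map_f (a \o inl)); rewrite mem_enum.
Qed.

(** Only the correction tracks of index below [k] count, and each marks at most one vertex. *)
Lemma card_rest a : #|[set x | in_rest (marks a x)]| <= k.
Proof.
apply: (@leq_trans (size (map (a \o inr) [seq i <- enum 'I_m | (i : 'I_m) < k]))).
  apply: card_preim_Some => x.
  rewrite inE => /existsP[i /andP[ltik]]; rewrite in_marks => /eqP <-.
  by apply: (map_f (a \o inr)); rewrite mem_filter ltik mem_enum.
rewrite size_map size_filter.
have -> : count (fun i : 'I_m => i < k) (enum 'I_m) = count (ltn^~ k) (iota 0 m).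
  by rewrite -val_enum_ord count_map.
rewrite -size_filter.
rewrite -[leqRHS](size_iota 0); apply: uniq_leq_size.
  by rewrite filter_uniq ?iota_uniq.
by move=> i; rewrite mem_filter !mem_iota add0n => /andP[ltik _]; exact: ltik.
Qed.

(* Start from the neighbourhood of the dominating vertices coloured [true]: the
   vertices coloured wrongly are those outside every neighbourhood, and at most
   [d] further ones for each dominating vertex. *)
Lemma dominating_guess a C : almost_dominating a -> dcut_colouring d C ->
  exists a', dcut_colouring d (colour a').
Proof.
move=> /allP dom; set S := [set x | in_base (marks a x)].
set R := [set x | in_rest (marks a x)].
case/andP=> mixC validC; pose S1 := [set x in S | C x].
pose N1 y := has (fun x => adj x y && (x \in S1)) (enum G).
pose W := [set y | C y != N1 y].
have leS1 : #|S1| <= k.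
  apply: leq_trans (card_base a); apply/subset_leq_card/subsetP => x.
  by rewrite /S1 in_set => /andP[].
have leW : #|W| <= m.
  pose F x := [set y | adj x y && (C x != C y)].
  (* A wrongly coloured [y] outside [R] has a neighbour in [S]. If [C y], this neighbour is not in
     [S1] and has the other colour; otherwise [N1 y] provides a neighbour in [S1], of colour [true].
     Either way a bichromatic edge joins [y] to [S]. *)
  have subW : W \subset R :|: \bigcup_(x in S) F x.
    apply/subsetP => y; rewrite !inE => wy.
    have /orP[/hasP[x _ /andP[xy xS]]|->//] := dom y (mem_enum G y).
    have xS' : x \in S by rewrite inE.
    have {wy} : N1 y = ~~ C y by move: wy; case: (C y); case: (N1 y).
    case Cy: (C y) => N1y.
      apply/orP; right; apply/bigcupP; exists x => //; rewrite inE xy Cy /=.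
      rewrite eqb_id; apply: contraFT N1y; rewrite negbK => Cx; apply/hasP; exists x.
        by rewrite mem_enum.
      by rewrite xy /S1 in_set xS' Cx.
    have [z _ /andP[zy]] := hasP N1y; rewrite /S1 in_set => /andP[zS Cz].
    apply/orP; right; apply/bigcupP; exists z => //.
    by rewrite inE zy Cz Cy.
  apply: leq_trans (subset_leq_card subW) _; rewrite mulSn.
  apply: leq_trans (leq_card_setU _ _) _; apply: leq_add (card_rest a) _.
  (* Besides the at most [k] vertices of [R], each of the at most [k] vertices of [S] contributes at
     most [d], in total [d.+1 * k]. *)
  have: #|\bigcup_(x in S) F x| <= \sum_(x in S) #|F x|.
    apply: (big_ind2 (fun (A : {set G}) q => #|A| <= q)) => //; rewrite ?cards0 //.
    by move=> A q B r leA leB; apply: leq_trans (leq_card_setU _ _) (leq_add leA leB).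
  move/leq_trans; apply; apply: (@leq_trans (\sum_(x in S) d)); last first.
    by rewrite sum_nat_const mulnC leq_mul2l card_base orbT.
  apply: leq_sum => x _; rewrite leqNgt; apply: contra validC => ltd.
  apply/hasP; exists x; rewrite ?mem_enum //.
  rewrite -size_filter (leq_trans ltd) // cardE uniq_leq_size ?enum_uniq // => y.
  by rewrite mem_enum mem_filter mem_enum inE => ->.
exists (guess S1 W); rewrite (_ : colour _ = C); first by apply/andP.
apply: functional_extensionality => y; rewrite /colour in_flip_guess //.
have -> : covered (guess S1 W) y = N1 y.
  by apply: eq_has => x; rewrite in_base_guess.
by rewrite inE; case: (C y); case: (N1 y).
Qed.

(** A vertex outside [S] without a neighbour in [S] would complete the copy of [H] to an induced
    copy of [dunion H P1]. *)
Lemma induced_dominating (H : sgraph) S : #|H| = k -> Defs.free (dunion H P1) G ->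
  isomorphic (induced S) H -> exists a, almost_dominating a.
Proof.
move=> cardH freeHP [f bijf adjf].
have cardS : #|S| = k by rewrite -cardH -(bij_eq_card bijf) /= card_sig.
(* [S] is used twice: as the dominating set and as the set of exempt vertices, since its members may
   lack neighbours inside [S]. *)
exists (guess S S); apply/allP => y _.
have [yS|yS] := boolP (y \in S); first by rewrite in_rest_guess ?cardS ?orbT.
apply/orP; left; apply: contraT => /hasPn Ny; case: freeHP; exists (y |: S).
have {}Ny x : x \in S -> adj x y = false.
  move=> xS; have := Ny x; rewrite mem_enum in_base_guess ?cardS // xS andbT.
  by move/(_ isT)/negbTE.
have [g fK gK] := bijf.
have inS (x : induced S) : val x \in y |: S by rewrite inE (valP x) orbT.
(* The only vertex of [y |: S] on which [insub] fails is [y], which becomes the isolated vertex. *)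
pose F (u : induced (y |: S)) : dunion H P1 :=
  if insub (val u) is Some v then inl (f v) else inr tt.
pose K (h : dunion H P1) : induced (y |: S) :=
  match h with
  | inl h' => exist _ (val (g h')) (inS (g h'))
  | inr _ => exist _ y (setU11 y S)
  end.
exists F.
  exists K => [u|[h|[]]]; rewrite /F.
  - apply: val_inj; case: insubP => [v _ vE|] /=; first by rewrite fK.
    by case: u => u /=; rewrite !inE => /orP[/eqP->|->].
  - by rewrite /= valK gK.
  - by rewrite /= insubN.
move=> u v; rewrite /F; case: insubP => [u' _ uE|uS]; case: insubP => [v' _ vE|vS].
- by rewrite /= adjf -[LHS]/(adj (val u') (val v')) uE vE.
- have := valP v; rewrite !inE (negbTE vS) orbF => /eqP vy.
  by rewrite /= /induced_adj vy Ny // -uE (valP u').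
- have := valP u; rewrite !inE (negbTE uS) orbF => /eqP uy.
  by rewrite /= /induced_adj uy adj_sym Ny // -vE (valP v').
have := (valP u, valP v); rewrite !inE (negbTE uS) (negbTE vS) !orbF.
by case=> /eqP uy /eqP vy; rewrite /= /induced_adj uy vy adj_irrefl.
Qed.

End Domination.
(** * Handing over to the given machine *)

Section Hybrid.
Variables (M : tm) (T : finType) (m : flow T unit (option bool)).
Notation t := (tm_tapes M).
Notation icell := (option (bool + (tm_work M + T))).
Implicit Types (i : 'I_t.+3) (j : 'I_t.+1) (c : conf T).

Definition as_bit (x : icell) : option bool :=
  if x is Some (inl b) then Some b else None.

Definition as_symbol (x : icell) : option T :=
  if x is Some (inr (inr s)) then Some s else None.

Definition as_cell (x : icell) : cell M :=
  match x with
  | Some (inl b) => Some (inl b)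
  | Some (inr (inl s)) => Some (inr s)
  | _ => None
  end.

Definition of_bit (x : option bool) : icell := omap inl x.

Definition of_symbol (x : option T) : icell := omap (inr \o inr) x.

Definition of_cell (x : cell M) : icell :=
  match x with
  | Some (inl b) => Some (inl b)
  | Some (inr s) => Some (inr (inl s))
  | None => None
  end.

Lemma of_bitK : cancel of_bit as_bit. Proof. by move=> [b|]. Qed.
Lemma of_symbolK : cancel of_symbol as_symbol. Proof. by move=> [s|]. Qed.
Lemma of_cellK : cancel of_cell as_cell. Proof. by move=> [[b|s]|]. Qed.

(** Tapes [0] to [t] are those of [M], with the input tape shared; the search writes only on the two
    extra tapes behind them. *)
Definition col_index : 'I_t.+3 := inord t.+1.
Definition row_index : 'I_t.+3 := ord_max.

Lemma le_tapes : t.+1 <= t.+3. Proof. exact: leqW (leqnSn _). Qed.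

Definition hybrid_state : finType := ((fstate m + bool) + tm_state M)%type.

(** The answer [None] means undecided and starts [M]. *)
Definition next (o : fstate m + option bool) : hybrid_state :=
  match o with
  | inl s => inl (inl s)
  | inr (Some b) => inl (inr b)
  | inr None => inr (tm_start M)
  end.

Definition hybrid_delta (s : hybrid_state) (rd : {ffun 'I_t.+3 -> icell}) :
    hybrid_state * {ffun 'I_t.+3 -> icell * move} :=
  match s with
  | inl (inl s) =>
      let p := fdelta s (as_bit (rd ord0)) (as_symbol (rd col_index))
                 (as_symbol (rd row_index)) in
      (next p.1,
       [ffun i => if i == ord0 then (rd i, imove p.2)
                  else if i == col_index then (of_symbol (cwrite p.2), cmove p.2)
                  else if i == row_index then (of_symbol (rwrite p.2), rmove p.2)
                  else (rd i, Stay)])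
  | inl (inr b) => (s, [ffun i => (rd i, Stay)])
  | inr s =>
      let p := tm_delta s [ffun j => as_cell (rd (widen_ord le_tapes j))] in
      (inr p.1,
       [ffun i : 'I_t.+3 => if i < t.+1
                  then (of_cell (p.2 (inord i)).1, (p.2 (inord i)).2)
                  else (rd i, Stay)])
  end.

Definition hybrid : tm :=
  @TM hybrid_state (tm_work M + T)%type t.+2 (inl (inl (fstart m tt)))
    (fun s => match s with
              | inl (inl _) => None
              | inl (inr b) => Some b
              | inr s => tm_verdict s
              end) hybrid_delta.

(** * Correctness of the combined machine *)

Section Runs.
Variable w : seq bool.

Definition lift_conf (s : hybrid_state) c : config hybrid :=
  @Config hybrid s
    (fun i z => if i == ord0 then of_bit (tape_of w z)
                else if i == col_index then of_symbol (ctp c z)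
                else if i == row_index then of_symbol (rtp c z)
                else None)
    (fun i => if i == ord0 then ihead c else if i == col_index then chd c
              else if i == row_index then rhd c else 0%R).

Lemma col_neq0 : (col_index == ord0) = false.
Proof. by rewrite -val_eqE /= inordK. Qed.

Lemma row_neq_col : (row_index == col_index) = false.
Proof. by rewrite -val_eqE /= inordK // eqn_leq ltnn. Qed.

Lemma step_lift_conf s c :
  step (lift_conf (inl (inl s)) c)
  = lift_conf (next (fstep w (inl s, c)).1) (fstep w (inl s, c)).2.
Proof.
rewrite /step /= /fstep /= !ffunE !eqxx col_neq0 row_neq_col.
rewrite of_bitK !of_symbolK; case: (fdelta _ _ _ _) => [o a] /=.
rewrite /lift_conf; congr Config; apply: functional_extensionality => i.
  apply: functional_extensionality => z; rewrite !ffunE /= /write.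
  case: (i == ord0) => /=; first by case: eqP => // ->.
  case: (i == col_index) => /=; first by case: (z == chd c).
  case: (i == row_index) => /=; first by case: (z == rhd c).
  by case: (z == 0%R).
rewrite !ffunE; case: (i == ord0) => //=.
by case: (i == col_index) => //=; case: (i == row_index) => //=; rewrite GRing.addr0.
Qed.

Lemma run_lift_conf c o c' n : run w m tt c o c' n ->
  exists2 n', n' <= n &
    iter n' (@step hybrid) (lift_conf (inl (inl (fstart m tt))) c)
    = lift_conf (next (inr o)) c'.
Proof.
rewrite /run; move: (fstart m tt) => s; elim: n s c => // n IHn s c.
rewrite iterSr; case E: (fstep w (inl s, c)) => [[s1|o1] c1] Hn.
  have [n' le_n' H] := IHn s1 c1 Hn; exists n'.+1 => //.
  by rewrite iterSr step_lift_conf E.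
move: Hn; rewrite iter_exit => -[<- <-]; exists 1 => //.
by rewrite /= step_lift_conf E.
Qed.

Lemma init_lift_conf : init hybrid w
  = lift_conf (inl (inl (fstart m tt)))
      (Conf 0%R (fun=> None) 0%R (fun=> None) 0%R).
Proof.
rewrite /lift_conf; congr Config; apply: functional_extensionality => i; last first.
  by case: (i == ord0); case: (i == col_index); case: (i == row_index).
apply: functional_extensionality => -[z|z]; last first.
  by case: (i == ord0); case: (i == col_index); case: (i == row_index).
case: (i == ord0); last by case: (i == col_index); case: (i == row_index).
by rewrite /tape_of; elim: w z => [|b v IHv] [|z] //=.
Qed.

(** Only the tapes of [M] are compared: whatever the search left on the two extra tapes is out of
    its reach. *)
Definition simulates (c : config M) (c' : config hybrid) :=
  cstate c' = inr (cstate c) /\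
  forall j, (forall z, ctape c' (widen_ord le_tapes j) z = of_cell (ctape c j z)) /\
            chead c' (widen_ord le_tapes j) = chead c j.

Lemma simulates_step (c : config M) (c' : config hybrid) :
  simulates c c' -> simulates (step c) (step c').
Proof.
move=> [sE tapeE]; rewrite /step sE /=; case: (tm_verdict _) => [b|//].
  by split.
have -> : [ffun j => as_cell ([ffun i => ctape c' i (chead c' i)] (widen_ord le_tapes j))]
  = [ffun j => ctape c j (chead c j)].
  apply/ffunP => j; rewrite !ffunE; have [-> ->] := tapeE j; exact: of_cellK.
case: (tm_delta _ _) => s a /=; split=> // j; have [tE hE] := tapeE j.
have ltj : widen_ord le_tapes j < t.+1 by exact: ltn_ord j.
have jE : inord (widen_ord le_tapes j) = j by apply: val_inj; rewrite /= inordK.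
split=> [z|] /=; rewrite !ffunE ltj jE hE //= tE.
by case: eqP.
Qed.

(** The search preserves the input and leaves the work tapes of [M] blank, so once the input head is
    home, [M] sees its initial configuration. *)
Lemma simulates_lift_conf c : ihead c = 0%R ->
  simulates (init M w) (lift_conf (next (inr None)) c).
Proof.
move=> hc; split=> // j /=.
have -> : (widen_ord le_tapes j == col_index) = false.
  by rewrite -val_eqE /= inordK // ltn_eqF.
have -> : (widen_ord le_tapes j == row_index) = false.
  by rewrite -val_eqE /= ltn_eqF // leqW.
rewrite -!val_eqE /=; case: (val j == 0) => //; split=> // -[z|z] //.
by rewrite /tape_of; elim: w z => [|b v IHv] [|z] //=.
Qed.

Lemma hybrid_answers o c n :
  run w m tt (Conf 0%R (fun=> None) 0%R (fun=> None) 0%R) o c n ->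
  if o is Some b then answers_within hybrid w n b
  else ihead c = 0%R -> forall p b, answers_within M w p b ->
       answers_within hybrid w (n + p) b.
Proof.
case/run_lift_conf=> n' le_n'; rewrite -init_lift_conf.
case: o => [b|] runE; first by exists n' => //; rewrite runE.
move=> hc p b [q le_qp vE]; exists (q + n'); first by rewrite addnC leq_add.
rewrite iterD runE; have sim := simulates_lift_conf hc.
suff: simulates (iter q (@step M) (init M w))
        (iter q (@step hybrid) (lift_conf (next (inr None)) c)).
  by case=> -> _; exact: vE.
by elim: q {le_qp vE} => //= q; apply: simulates_step.
Qed.

End Runs.
End Hybrid.

(** * The combined decision procedure *)

Section Decision.
Variables (k d : nat).
Notation m := (d.+1 * k).
Notation J := ('I_k + 'I_m)%type.
Notation T := (bool * {set J})%type.

Definition accept (b : bool) : unit + option bool :=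
  if b then inr (Some true) else inl tt.

(** A dominating choice makes the failure of the cut search conclusive; without one the question is
    left to [M]. *)
Definition reject (b : bool) : option bool := if b then Some false else None.

Definition presolve : flow T unit (option bool) :=
  seqf (initialize (false, set0))
    (bindl (dimap id accept (search (enum {: J}) (dcut_leaf k m d)))
           (dimap id reject (search (enum {: J}) (dominating_leaf k m)))).

(** Initialization accounts for 7, and each of the two searches for [50 + 6 * #|{: J}|]. *)
Definition presolve_time n := (107 + 12 * #|{: J}|) * n ^ (#|{: J}| + 2).

Lemma run_presolve (G : sgraph) : exists o c,
  run (encode G) presolve tt (Conf 0%R (fun=> None) 0%R (fun=> None) 0%R) o c
    (presolve_time #|G|.+1) /\
  match o with
  | Some true => exists a : J -> option G, dcut_colouring d (colour a)
  | Some false => (forall a : J -> option G, ~~ dcut_colouring d (colour a)) /\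
                  exists a : J -> option G, almost_dominating a
  | None => ihead c = 0%R /\ forall a : J -> option G, ~~ almost_dominating a
  end.
Proof.
set n := #|G|; pose a0 : J -> option G := fun=> None.
have cells0 : nseq n (false, set0) = cells (fun=> false) a0.
  rewrite /cells (_ : (fun x => _) = fun=> (false, set0)).
    by rewrite /n cardE; elim: (enum G) => //= x s ->.
  by apply: functional_extensionality => x; congr (_, _).
have run0 := run_initialize (false, set0 : {set J}) (encodeE G).
rewrite {1}cells0 in run0.
(* All tracks are searched, so [agree_off] does not restrict the choice. *)
have agree_all (a a' : J -> option G) : agree_off (enum {: J}) a a'.
  by move=> j; rewrite mem_enum.
have szE : size (enum {: J}) = #|{: J}| by rewrite cardE.
have find1 := searches_search (enum_uniq {: J}) (@searches_dcut_leaf k m d G).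
have find2 := searches_search (enum_uniq {: J}) (@searches_dominating_leaf k m G).
rewrite szE in find1 find2.
have [b1 [c1 [run1 P1]]] := find1 a0 (fun=> false) (nseq n (false, set0))
  (fun _ _ => erefl) (size_nseq _ _).
have le_n : 4 * n + 7 <= 7 * n.+1 ^ (#|{: J}| + 2).
  have: n.+1 <= n.+1 ^ (#|{: J}| + 2) by rewrite addnS expnS leq_pmulr ?expn_gt0.
  by move: (_ ^ _); lia.
case: b1 run1 P1 => run1.
  case=> a _ Pa; exists (Some true), c1; split; last by exists a.
  apply: (run_weaken _ (run_seqf run0 (run_bindl_exit _
    (run_dimap (f := id) accept run1)))).
  by rewrite /presolve_time -/n; move: (n.+1 ^ _) le_n; nia.
(* A failed search restores empty tracks; the leftover colours [C2] and row tape [r2] are a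
   legitimate start for the second search. *)
case=> -[C2 [r2 [c1E szr2]]] N1; rewrite {}c1E in run1.
have [b2 [c2 [run2 P2]]] := find2 a0 C2 r2 (fun _ _ => erefl) szr2.
exists (reject b2), c2; split.
  apply: (run_weaken _ (run_seqf run0 (run_bindl (run_dimap (f := id) accept run1)
    (run_dimap (f := id) reject run2)))).
  by rewrite /presolve_time -/n; move: (n.+1 ^ _) le_n; nia.
case: b2 {run2} P2 => [[a _ Pa]|[[C3 [r3 [-> _]]] N2]].
  by split; [move=> a'; apply: N1 | exists a].
by split=> // a; apply: N2.
Qed.

End Decision.

Theorem theorem12 (H : sgraph) (d : nat) (hd : 2 <= d) :
  dcut_poly_time d H -> dcut_poly_time d (dunion H P1).
Proof.
move=> [M [q solveM]]; set k := #|H|.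
pose K := #|{: 'I_k + 'I_(d.+1 * k)}|.
(* The exponent depends only on [d] and [#|H|]; [q] pays for the run of [M]. *)
pose p : {poly nat} := ((107 + 12 * K)%:P * 'X^(K + 2) + q)%R.
exists (hybrid M (presolve k d)), p => G [conG freeG].
have szG : #|G|.+1 <= size (encode G).
  by rewrite size_cat size_nseq /= addnS ltnS leq_addr.
have le_p : presolve_time k d #|G|.+1 + q.[size (encode G)]%R <= p.[size (encode G)]%R.
  rewrite /p hornerD hornerCM hornerXn; apply: leq_add => //.
  rewrite /presolve_time -/K; have -> (x e : nat) : (x ^+ e)%R = x ^ e.
    by elim: e => // e IHe; rewrite GRing.exprS expnS IHe.
  by rewrite leq_mul2l leq_exp2r ?addnS ?szG ?orbT.
have weaken t b : answers_within (hybrid M (presolve k d)) (encode G) t b ->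
    t <= p.[size (encode G)]%R ->
    answers_within (hybrid M (presolve k d)) (encode G) p.[size (encode G)]%R b.
  by move=> [s le_st vE] le_tp; exists s => //; apply: leq_trans le_tp.
have [o [c [run_o]]] := run_presolve k d G.
have := hybrid_answers M run_o.
case: o {run_o} => [[]|] ans => [[a Pa]|[Na [a Pa]]|[hc Na]].
- exists true; last by apply: (weaken _ _ ans); apply: leq_trans le_p; apply: leq_addr.
  by split=> // _; apply/has_dcut_colouring; exists (colour a).
- exists false; last by apply: (weaken _ _ ans); apply: leq_trans le_p; apply: leq_addr.
  (* Since a dominating choice exists, any [d]-cut would yield one of the guessed colourings, all of
     which failed. *)
  split=> // /has_dcut_colouring[C PC].
  have [a' Pa'] := dominating_guess Pa PC.
  by rewrite (negbTE (Na a')) in Pa'.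
(* An induced copy of [H] would give a dominating choice, so [G] lies in the class on which [M] is
   correct. *)
have freeH : Defs.free H G.
  move=> [S isoS]; have [a Pa] := induced_dominating d (erefl k) freeG isoS.
  by rewrite (negbTE (Na a)) in Pa.
have [b bP ansM] := solveM G (conj conG freeH).
by exists b => //; apply: (weaken _ _ (ans hc _ _ ansM)).
Qed.
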